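(* Let $V\in\mathcal{O}_{\mathcal{L}}$ be a simple $\mathcal L$-module on which $z_3$ acts nontrivially. If $V$ contains a simple $\mathcal{H}$-submodule $H$, then $V\cong H(\dot z_2)\otimes U^{\mathcal{L}}$ as $\mathcal{L}$-modules for some $\dot z_2\in\mathbb{C}$ and some simple module $U\in\mathcal{O}_{\mathrm{Vir}}$.
   Context: $\mathcal{L}$ has basis $\{d_n,I_n,z_1,z_2,z_3\mid n\in\mathbb{Z}\}$ with brackets $[d_n,d_m]=(m-n)d_{m+n}+\delta_{n,-m}\frac{n^3-n}{12}z_1$, $[d_n,I_m]=mI_{m+n}+\delta_{n,-m}(n^2+n)z_2$, $[I_n,I_m]=n\delta_{n,-m}z_3$, $z_i$ central; $\mathrm{Vir}=\mathrm{span}\{d_i,z_1\}$, $\mathcal{H}=\mathrm{span}\{I_i,z_3\}$, graded by $\deg d_i=\deg I_i=i$, $\deg z_j=0$. For a graded Lie algebra $L=\bigoplus L_i$, $\mathcal{O}_L$ is the category of $L$-modules $V$ such that for every $v\in V$ there is $n>0$ with $L_iv=0$ for all $i\ge n$. For a $\mathrm{Vir}$-module $U$, $U^{\mathcal{L}}$ is the $\mathcal L$-module with $\mathbb{C}z_2+\mathcal{H}$ acting as $0$. For a simple $H\in\mathcal O_{\mathcal H}$ with $z_3$ acting as a nonzero scalar $\dot z_3$ and $\dot z_2\in\mathbb C$, $H(\dot z_2)$ is the $\mathcal L$-module on $H$ extending the $\mathcal H$-action with $z_1=1-12\dot z_2^2/\dot z_3$, $z_2=\dot z_2$, $z_3=\dot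 z_3$, $d_k=-\frac{1}{2\dot z_3}\sum_{i\in\mathbb Z}:I_{-i}I_{i+k}:+\frac{(k+1)\dot z_2}{\dot z_3}I_k$, where $:I_iI_j:=I_iI_j$ if $i<j$ and $=I_jI_i$ otherwise. *)

(* Defs.v *)
(* Field of scalars: C := R[i] = complex R for an arbitrary
   R : realType (every realType is isomorphic to the real numbers, so C is
   the field of complex numbers). *)
From HB Require Import structures.
From mathcomp Require Import all_boot all_order all_algebra.
From mathcomp Require Import reals complex.
Set Implicit Arguments. Unset Strict Implicit. Unset Printing Implicit Defensive.
Import Order.TTheory GRing.Theory Num.Theory.
Local Open Scope ring_scope.

Section Defs.
Variable R : realType.
Local Notation C := (R[i]).

Definition islin (V : lmodType C) (f : V -> V) : Prop :=
  forall (a : C) (x y : V), f (a *: x + y) = a *: f x + f y.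

Definition islinf (V : lmodType C) (f : V -> C) : Prop :=
  forall (a : C) (x y : V), f (a *: x + y) = a * f x + f y.

Definition subspace (V : lmodType C) (S : V -> Prop) : Prop :=
  S 0 /\ forall (a : C) (x y : V), S x -> S y -> S (a *: x + y).

Definition stable (V : lmodType C) (ops : (V -> V) -> Prop) (S : V -> Prop) :=
  forall f, ops f -> forall v, S v -> S (f v).

Definition submodule (V : lmodType C) (ops : (V -> V) -> Prop) (S : V -> Prop) :=
  subspace S /\ stable ops S.

Definition simple_sub (V : lmodType C) (ops : (V -> V) -> Prop) (W : V -> Prop) :=
  submodule ops W /\ (exists v, W v /\ v <> 0) /\
  forall S : V -> Prop, submodule ops S -> (forall v, S v -> W v) ->
     (forall v, S v -> v = 0) \/ (forall v, W v -> S v).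

Definition simple_mod (V : lmodType C) (ops : (V -> V) -> Prop) :=
  simple_sub ops (fun _ => True).

Definition delta (n m : int) : C := if n == - m then 1 else 0.

(* An L-module structure on V is given by the action of the basis elements
   d_n, I_n (n in Z), z1, z2, z3, which must be linear and satisfy the
   bracket relations (as commutators). *)
Definition is_Lmodule (V : lmodType C) (d I : int -> V -> V) (z1 z2 z3 : V -> V) :=
  (forall n, islin (d n)) /\ (forall n, islin (I n)) /\
  islin z1 /\ islin z2 /\ islin z3 /\
  (forall (n m : int) v, d n (d m v) - d m (d n v) =
      (m - n)%:~R *: d (n + m) v
      + (delta n m * ((n ^+ 3 - n)%:~R / 12%:R)) *: z1 v) /\
  (forall (n m : int) v, d n (I m v) - I m (d n v) =
      m%:~R *: I (m + n) v + (delta n m * (n ^+ 2 + n)%:~R) *: z2 v) /\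
  (forall (n m : int) v, I n (I m v) - I m (I n v) =
      (n%:~R * delta n m) *: z3 v) /\
  (forall z, (z = z1 \/ z = z2 \/ z = z3) ->
     (forall n v, z (d n v) = d n (z v)) /\ (forall n v, z (I n v) = I n (z v)) /\
     (forall v, z (z1 v) = z1 (z v)) /\ (forall v, z (z2 v) = z2 (z v)) /\
     (forall v, z (z3 v) = z3 (z v))).

Definition L_ops (V : lmodType C) (d I : int -> V -> V) (z1 z2 z3 : V -> V)
  : (V -> V) -> Prop :=
  fun f => (exists n, f = d n) \/ (exists n, f = I n) \/ f = z1 \/ f = z2 \/ f = z3.

Definition H_ops (V : lmodType C) (I : int -> V -> V) (z3 : V -> V)
  : (V -> V) -> Prop :=
  fun f => (exists n, f = I n) \/ f = z3.

(* category O_L (the positive part L_i, i >= n > 0, is spanned by d_i, I_i) *)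
Definition in_O_L (V : lmodType C) (d I : int -> V -> V) :=
  forall v : V, exists n : int, 0 < n /\ forall i, n <= i -> d i v = 0 /\ I i v = 0.

Definition is_Virmodule (U : lmodType C) (d : int -> U -> U) (z1 : U -> U) :=
  (forall n, islin (d n)) /\ islin z1 /\
  (forall (n m : int) u, d n (d m u) - d m (d n u) =
      (m - n)%:~R *: d (n + m) u
      + (delta n m * ((n ^+ 3 - n)%:~R / 12%:R)) *: z1 u) /\
  (forall n u, z1 (d n u) = d n (z1 u)).

Definition Vir_ops (U : lmodType C) (d : int -> U -> U) (z1 : U -> U)
  : (U -> U) -> Prop :=
  fun f => (exists n, f = d n) \/ f = z1.

Definition in_O_Vir (U : lmodType C) (d : int -> U -> U) :=
  forall u : U, exists n : int, 0 < n /\ forall i, n <= i -> d i u = 0.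

Definition nord (V : lmodType C) (I : int -> V -> V) (a b : int) (v : V) : V :=
  if a < b then I a (I b v) else I b (I a v).

(* the sum  sum_{i = -M}^{M} :I_{-i} I_{i+k}: v ; when I_j v = 0 for all
   j >= n and M >= n + |k|, every term with |i| > M vanishes, so this is
   the (finite) infinite sum of the paper. *)
Definition sug (V : lmodType C) (I : int -> V -> V) (k : int) (M : nat) (v : V) : V :=
  \sum_(j < (2 * M).+1) nord I (- (j%:Z - M%:Z)) ((j%:Z - M%:Z) + k) v.

(* d_k acting on H(z2dot), computed with the cut-off M *)
Definition Hd (V : lmodType C) (I : int -> V -> V) (z3d z2d : C)
    (k : int) (M : nat) (v : V) : V :=
  (- (2%:R * z3d)^-1) *: sug I k M v + (((k + 1)%:~R * z2d) / z3d) *: I k v.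

End Defs.

(* Main.v *)
Require Import Defs.
From HB Require Import structures.
From mathcomp Require Import finmap.
From mathcomp Require Import all_boot all_order all_algebra.
From mathcomp Require Import boolp classical_sets cardinality fsbigop.
From mathcomp Require Import reals complex ring lra zify.
From mathcomp Require lebesgue_measure.
Import Order.TTheory GRing.Theory Num.Theory.
Set Implicit Arguments. Unset Strict Implicit. Unset Printing Implicit Defensive.
Local Open Scope ring_scope.

(** Central elements act on [V] by scalars (Dixmier's form of Schur's lemma:
    [V] has countable dimension while the field is uncountable).  Since [z2] and
    [z3] are scalars, [z3] nonzero, the Sugawara operators [D_k] are defined on
    all of [V], where they satisfy [[D_k, I_m] = [d_k, I_m]] and the Virasoro
    relations with central charge [1 - 12 z2^2 / z3].  Hence [d_k - D_k] commutes
    with the Heisenberg algebra and gives a second Virasoro action, which acts on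
    the multiplicity space [U = Hom_H(H, V)].  Evaluation [H (x) U -> V] is
    injective because [End_H(H)] consists of scalars, its image is an
    L-submodule, and a submodule [U'] of [U] gives the L-submodule [H (x) U']. *)

(** * Linear operators and Dixmier's lemma *)

(** Modules in O are not assumed to have weight spaces, so no finite-dimensional eigenspace is at
    hand; every scalar (for [z2] and [z3] on V, for the endomorphisms of H) comes from one
    cardinality argument, which asks only for countably many generating operators. The sign of the
    Sugawara operator is forced: the sum [S_k] of normally ordered products satisfies [[S_k, I_m] =
    -2 m z3 I_(m+k)], and division by [-2 z3] gives the bracket of [d_k], up to the cocycle, which a
    multiple of [I_k] supplies. No tensor product type is built. An element of H (x) U is a list of
    pairs, and over a field it is zero exactly when every pair of linear functionals kills it. A
    homomorphism from H is recorded by its value at a fixed nonzero vector of H, so U is a subspace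
    of V and the second Virasoro action on it is a mere restriction. *)

Section Linear.
Variables (R : realType) (V : lmodType R[i]).
Implicit Types f : V -> V.

Lemma islinD f : islin f -> {morph f : x y / x + y}.
Proof. by move=> lf x y; have := lf 1 x y; rewrite !scale1r. Qed.

Lemma islin0 f : islin f -> f 0 = 0.
Proof. by move=> lf; apply: (addrI (f 0)); rewrite -(islinD lf) !addr0. Qed.

Lemma islinZ f : islin f -> forall a, {morph f : x / a *: x}.
Proof. by move=> lf a x; have := lf a x 0; rewrite (islin0 lf) !addr0. Qed.

Lemma islinN f : islin f -> {morph f : x / - x}.
Proof. by move=> lf x; rewrite -scaleN1r (islinZ lf) scaleN1r. Qed.

Lemma islinB f : islin f -> {morph f : x y / x - y}.
Proof. by move=> lf x y; rewrite (islinD lf) (islinN lf). Qed.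

Lemma islin_sum f (J : Type) (r : seq J) (P : pred J) (F : J -> V) :
  islin f -> f (\sum_(j <- r | P j) F j) = \sum_(j <- r | P j) f (F j).
Proof. by move=> lf; apply: (big_morph f (islinD lf) (islin0 lf)). Qed.

Section Subspace.
Variable S : V -> Prop.
Hypothesis subS : subspace S.

Lemma subspace0 : S 0. Proof. by case: subS. Qed.

Lemma subspaceD x y : S x -> S y -> S (x + y).
Proof. by case: subS => _ sS; move/(sS 1)/[apply]; rewrite scale1r. Qed.

Lemma subspaceZ a x : S x -> S (a *: x).
Proof. by case: subS => S0 sS Sx; rewrite -[a *: x]addr0; apply: sS. Qed.

Lemma subspaceB x y : S x -> S y -> S (x - y).
Proof. by move=> Sx Sy; rewrite -scaleN1r; apply/subspaceD/subspaceZ. Qed.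

Lemma subspace_sum (J : Type) (r : seq J) (P : pred J) (F : J -> V) :
  (forall j, P j -> S (F j)) -> S (\sum_(j <- r | P j) F j).
Proof. by move=> SF; elim/big_rec: _ => [|j x /SF]; [apply: subspace0|apply: subspaceD]. Qed.

End Subspace.
End Linear.

(** Otherwise the reals, hence [[0, 1]], would be countable and so Lebesgue-null, while that
    interval has measure 1. *)
Lemma real_not_bigcup_finite (R : realType) (F : nat -> set R) :
  (forall n, finite_set (F n)) -> exists x, forall n, ~ F n x.
Proof.
move=> finF; apply: contrapT => /forallNP allF.
have cntR : countable [set: R].
  rewrite (_ : setT = \bigcup_n F n)%classic.
    by apply: bigcup_countable => // n _; apply: finite_set_countable.
  apply/seteqP; split=> x // _; have /existsNP [n /contrapT Fx] := allF x.
  by exists n.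
have cnt01 : countable (`[0 : R, 1]%classic : set R).
  by apply: sub_countable cntR; apply: subset_card_le.
have := lebesgue_measure.countable_lebesgue_measure0 cnt01.
rewrite lebesgue_measure.lebesgue_measure_itv /= constructive_ereal.lte_fin ltr01.
by move=> [/eqP]; rewrite oppr0 addr0 oner_eq0.
Qed.

(** * Polynomials in one operator and independence of resolvents *)

Section OperatorPolynomial.
Variables (R : realType) (V : lmodType R[i]) (T : V -> V).
Hypothesis linT : islin T.
Local Notation C := R[i].

Definition op_horner (p : {poly C}) (v : V) : V :=
  \sum_(i < size p) p`_i *: iter i T v.

Lemma op_horner_wide n (p : {poly C}) v : (size p <= n)%N ->
  op_horner p v = \sum_(i < n) p`_i *: iter i T v.
Proof.
move=> lepn; rewrite /op_horner (big_ord_widen n (fun i => p`_i *: iter i T v)) //.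
rewrite big_mkcond; apply: eq_bigr => i _; case: ltnP => // lepi.
by rewrite nth_default // scale0r.
Qed.

Lemma op_hornerP a (p q : {poly C}) v :
  op_horner (a *: p + q) v = a *: op_horner p v + op_horner q v.
Proof.
have le1 : (size (a *: p + q)%R <= maxn (size p) (size q))%N.
  apply: leq_trans (size_polyD _ _) _.
  by rewrite geq_max !leq_max size_scale_leq /= leqnn orbT.
rewrite (op_horner_wide _ le1) (op_horner_wide _ (leq_maxl (size p) (size q))).
rewrite (op_horner_wide _ (leq_maxr (size p) (size q))) scaler_sumr -big_split /=.
by apply: eq_bigr => i _; rewrite coefD coefZ scalerDl scalerA.
Qed.

Lemma iter_islin n : islin (iter n T).
Proof. by elim: n => // n IHn a x y /=; rewrite IHn linT. Qed.

Lemma op_horner_islin (p : {poly C}) : islin (op_horner p).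
Proof.
move=> a x y; rewrite /op_horner scaler_sumr -big_split /=.
by apply: eq_bigr => i _; rewrite iter_islin scalerDr !scalerA mulrC.
Qed.

Lemma op_horner0 v : op_horner 0 v = 0.
Proof. by rewrite /op_horner size_poly0 big_ord0. Qed.

Lemma op_hornerZ a (p : {poly C}) v : op_horner (a *: p) v = a *: op_horner p v.
Proof. by rewrite -[a *: p]addr0 op_hornerP op_horner0 addr0. Qed.

Lemma op_horner_sum (J : Type) (r : seq J) (P : pred J) (F : J -> {poly C}) v :
  op_horner (\sum_(j <- r | P j) F j) v = \sum_(j <- r | P j) op_horner (F j) v.
Proof.
apply: (big_morph (op_horner^~ v)) => [p q|]; last exact: op_horner0.
by rewrite -[p]scale1r op_hornerP !scale1r.
Qed.

(** Moving one linear factor onto the argument is the only form of multiplicativity of [p(T)] that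
    is needed below. *)
Lemma op_hornerMXsubC (p : {poly C}) a v :
  op_horner (p * ('X - a%:P)) v = op_horner p (T v - a *: v).
Proof.
rewrite (islinB (op_horner_islin p)) (islinZ (op_horner_islin p)).
have -> : p * ('X - a%:P) = (- a) *: p + 'X * p by rewrite scaleNr -mul_polyC; ring.
rewrite op_hornerP scaleNr addrC; congr (_ - _). have leX : (size ('X * p)%R <= (size p).+1)%N.
  by rewrite mulrC; have [->|p0] := eqVneq p 0; rewrite ?mul0r ?size_poly0 ?size_mulX.
rewrite (op_horner_wide _ leX) big_ord_recl coefXM /= scale0r add0r.
by apply: eq_bigr => i _; rewrite coefXM /= -iterSr.
Qed.

Lemma op_horner_prodXsubC (rs : seq C) v :
  (forall a, a \in rs -> forall w, T w - a *: w = 0 -> w = 0) ->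
  op_horner (\prod_(a <- rs) ('X - a%:P)) v = 0 -> v = 0.
Proof.
elim: rs v => [|a rs IHrs] v inj.
  by rewrite big_nil /op_horner size_poly1 big_ord1 coef1 scale1r.
rewrite big_cons mulrC op_hornerMXsubC => /IHrs Tv0.
apply: (inj a); first exact: mem_head.
by apply: Tv0 => b rs_b; apply: inj; rewrite in_cons rs_b orbT.
Qed.

(** The field is algebraically closed, so [p(T)] is a nonzero scalar times a composite of injective
    operators [T - a]. *)
Lemma op_horner_inj (p : {poly C}) v :
  (forall a w, T w - a *: w = 0 -> w = 0) -> op_horner p v = 0 -> p != 0 -> v = 0.
Proof.
move=> inj pv0 p0; have [rs Dp] := closed_field_poly_normal p.
have /eqP := pv0; rewrite Dp op_hornerZ scaler_eq0 lead_coef_eq0 (negPf p0) /= => /eqP.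
by apply: op_horner_prodXsubC => a _; apply: inj.
Qed.

(* Applying [prod_j (T - a_j)] to a linear relation between the [(T - a_i)^-1 v]
   gives [p(T) v = 0], where the Lagrange-type polynomial [p] takes the
   value [c_k * prod_(j != k) (a_k - a_j)] at [a_k]. *)
Lemma resolvent_free n (a : 'I_n -> C) (w : 'I_n -> V) v (c : 'I_n -> C) :
  (forall b w, T w - b *: w = 0 -> w = 0) -> injective a -> v <> 0 ->
  (forall i, T (w i) - a i *: w i = v) ->
  \sum_i c i *: w i = 0 -> forall i, c i = 0.
Proof.
move=> inj inj_a v0 wv cw0 k.
pose p := \sum_i c i *: \prod_(j | j != i) ('X - (a j)%:P).
have pv : op_horner p v = 0.
  have /(congr1 (op_horner (\prod_j ('X - (a j)%:P)))) := cw0.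
  rewrite islin0; last exact: op_horner_islin.
  rewrite islin_sum; last exact: op_horner_islin.
  move=> <-; rewrite op_horner_sum; apply: eq_bigr => i _.
  rewrite op_hornerZ islinZ; last exact: op_horner_islin.
  by rewrite [in RHS](bigD1 i) //= mulrC op_hornerMXsubC wv.
have p0 : p = 0 by apply: contra_notP v0 => /eqP; apply: op_horner_inj pv.
have /eqP := congr1 (horner^~ (a k)) p0.
rewrite horner0 horner_sum (bigD1 k) //= [X in _ + X]big1 => [|i ik]; last first.
  by rewrite hornerZ horner_prod (bigD1 k) 1?eq_sym //= hornerXsubC subrr mul0r mulr0.
rewrite addr0 hornerZ horner_prod mulf_eq0 => /orP[/eqP //|/prodf_eq0[j jk]].
by rewrite hornerXsubC subr_eq0 => /eqP/inj_a kj; rewrite kj eqxx in jk.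
Qed.

End OperatorPolynomial.

(** * Spans of initial segments of a sequence *)

Section CountableSpan.
Variables (R : realType) (V : lmodType R[i]) (e : nat -> V).

Definition spanned n (v : V) := exists c : nat -> R[i], v = \sum_(i < n) c i *: e i.

Lemma spanned_subspace n : subspace (spanned n).
Proof.
split=> [|a x y [c ->] [c' ->]].
  by exists (fun _ => 0); rewrite big1 // => i _; rewrite scale0r.
exists (fun i => a * c i + c' i); rewrite scaler_sumr -big_split /=.
by apply: eq_bigr => i _; rewrite scalerDl scalerA.
Qed.

Lemma spanned_leq n m v : (n <= m)%N -> spanned n v -> spanned m v.
Proof.
move=> lenm [c ->]; exists (fun i => if (i < n)%N then c i else 0).
rewrite (big_ord_widen m (fun i => c i *: e i)) // big_mkcond.
by apply: eq_bigr => i _; case: ifP => //; rewrite scale0r.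
Qed.

Lemma spanned_basis n : spanned n.+1 (e n).
Proof.
exists (fun i => (i == n)%:R); rewrite (bigD1 ord_max) //= eqxx scale1r big1 ?addr0 // => i.
by rewrite -val_eqE /= => /negPf->; rewrite scale0r.
Qed.

Lemma ex_spanned_subspace : subspace (fun v => exists n, spanned n v).
Proof.
split=> [|a x y [n xn] [m ym]]; first by exists 0%N; apply: (spanned_subspace 0).1.
exists (maxn n m); apply: (spanned_subspace _).2.
  exact: spanned_leq (leq_maxl _ _) xn.
exact: spanned_leq (leq_maxr _ _) ym.
Qed.

(** The coordinates form a matrix with [n + 1] rows and [n] columns; a nonzero row of its left
    kernel is the relation. *)
Lemma spanned_dependent n (w : 'I_n.+1 -> V) : (forall i, spanned n (w i)) ->
  exists2 c : 'I_n.+1 -> R[i], \sum_i c i *: w i = 0 & exists i, c i != 0.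
Proof.
move=> wn; have [A wA] := choice wn.
pose M := \matrix_(i < n.+1, j < n) A i j.
have /rowV0Pn[x /sub_kermxP xM0 /rV0Pn[i xi0]] : kermx M != 0.
  by rewrite kermx_eq0 /row_free ltn_eqF // ltnS rank_leq_col.
exists (x 0); last by exists i.
transitivity (\sum_(j < n) (x *m M) 0 j *: e j); last first.
  by rewrite xM0 big1 // => j _; rewrite mxE scale0r.
under [RHS]eq_bigr => j _ do rewrite mxE scaler_suml.
rewrite exchange_big; apply: eq_bigr => k _.
by rewrite wA scaler_sumr; apply: eq_bigr => j _; rewrite mxE scalerA.
Qed.

End CountableSpan.

(** * Dixmier's form of Schur's lemma *)

Section Schur.
Variables (R : realType) (V : lmodType R[i]) (ops : (V -> V) -> Prop).
Variable E : nat -> V -> V.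
Hypothesis opsE : forall f, ops f <-> exists n, f = E n.
Hypothesis ops_lin : forall f, ops f -> islin f.
Hypothesis simpleV : simple_mod ops.

Lemma E_islin n : islin (E n).
Proof. by apply/ops_lin/opsE; exists n. Qed.

Lemma submodule_full (S : V -> Prop) : submodule ops S ->
  (exists2 v, S v & v <> 0) -> forall v, S v.
Proof.
move=> subS [v Sv v0] w; have [_ [_ /(_ S subS)[]]] := simpleV => //.
  by move=> /(_ v Sv).
by apply.
Qed.

(** Enumerates the monomials in the operators [E i] applied to [w]; a number that codes no list
    stands for the empty word. *)
Definition word_vector (w : V) (n : nat) : V :=
  foldr E w (odflt [::] (unpickle n)).

(** Prepending a letter to a word keeps the span of all word vectors stable, and it contains [w]. *)
Lemma simple_countably_spanned w : w <> 0 -> forall v, exists n, spanned (word_vector w) n v.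
Proof.
move=> w0; apply: submodule_full; last first.
  exists w => //; exists (pickle ([::] : seq nat)).+1.
  by have := spanned_basis (word_vector w) (pickle ([::] : seq nat)); rewrite /word_vector pickleK.
have subS := ex_spanned_subspace (word_vector w); split=> // f /opsE[m ->] v [n [c ->]].
rewrite (islin_sum _ _ _ (E_islin m)); apply: (subspace_sum subS) => i _.
rewrite (islinZ (E_islin m)); apply: (subspaceZ subS).
pose s := m :: odflt [::] (unpickle i); exists (pickle s).+1.
by have := spanned_basis (word_vector w) (pickle s); rewrite {2}/word_vector pickleK.
Qed.

(* Dixmier's argument: a commuting [T] without eigenvalue would make the
   uncountably many vectors [(T - a)^-1 w] independent in a space of countable
   dimension. *)
Lemma dixmier_schur (T : V -> V) : islin T ->
  (forall f v, ops f -> T (f v) = f (T v)) -> exists a, forall v, T v = a *: v.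
Proof.
move=> linT commT; apply: contrapT => /forallNP noeig.
have linTa a : islin (fun v => T v - a *: v).
  move=> b x y; rewrite linT scalerBr !scalerA mulrC scalerDr scalerA opprD.
  by rewrite -!addrA; congr (_ + _); rewrite addrCA.
have commTa a f v : ops f -> T (f v) - a *: f v = f (T v - a *: v).
  move=> opsf; have lf := ops_lin opsf.
  by rewrite commT // (islinB lf) (islinZ lf).
have injTa a v : T v - a *: v = 0 -> v = 0.
  move=> Tv; apply: contrapT => v0; apply: (noeig a) => x; apply/eqP; rewrite -subr_eq0; apply/eqP.
  apply: (@submodule_full (fun x => T x - a *: x = 0)); last by exists v.
  split; first split=> [|b y z Ty Tz].
  - exact: islin0 (linTa a).
  - by rewrite (linTa a) Ty Tz scaler0 addr0.
  - by move=> f opsf y Ty; rewrite commTa // Ty islin0 //; apply: ops_lin.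
have [_ [[w [_ w0]] _]] := simpleV.
have surjTa a : exists v, T v - a *: v = w.
  apply: (@submodule_full (fun x => exists v, T v - a *: v = x)); last first.
    by exists (T w - a *: w); [exists w|move/injTa].
  split; first split=> [|b _ _ [x <-] [y <-]].
  - by exists 0; apply: islin0 (linTa a).
  - by exists (b *: x + y); rewrite (linTa a).
  - by move=> f opsf _ [x <-]; exists (f x); rewrite commTa.
have [r rw] := choice surjTa.
(* Real parameters suffice: [n + 1] of them in [F n] would give [n + 1] independent vectors in a
   span of [n]. So every [F n] is finite and some real lies in none of them. *)
pose F n : set R := [set x : R | spanned (word_vector w) n (r x%:C%C)]%classic.
have finF n : finite_set (F n).
  apply: contrapT => /(infinite_set_fset n.+1)[B BF leB].
  pose a (i : 'I_n.+1) : R := nth 0 B i.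
  have FB i : F n (a i).
    by apply: BF => /=; apply: mem_nth; apply: leq_trans leB.
  have [c c0 [i ci]] := spanned_dependent FB.
  move/eqP: ci; apply.
  apply: (resolvent_free linT injTa _ w0 (fun i => rw (a i)%:C%C) c0) => j k /complexI /eqP.
  by rewrite nth_uniq ?fset_uniq //; [move/eqP/val_inj|apply: leq_trans leB..].
have [x Fx] := real_not_bigcup_finite finF.
by have [n] := simple_countably_spanned w0 (r x%:C%C); apply: Fx.
Qed.

End Schur.

(** * Subspaces as module types *)

Section SubspaceType.
Variables (R : realType) (V : lmodType R[i]) (S : V -> Prop).
Hypothesis subS : subspace S.

(** The proof is an argument so that the instance below can recover the closure property from the
    term [subspace_pred subS]. *)
Definition subspace_pred (_ : subspace S) : {pred V} := [pred v | `[< S v >]].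

Lemma subspace_pred_closed : submod_closed (subspace_pred subS).
Proof.
split; first by apply/asboolP; apply: subspace0.
move=> a x y /asboolP Sx /asboolP Sy; apply/asboolP.
by apply: subspaceD => //; apply: subspaceZ.
Qed.

HB.instance Definition _ :=
  GRing.isSubmodClosed.Build R[i] V (subspace_pred subS) subspace_pred_closed.

Record subspace_type := SubspaceType {
  subspace_val :> V; subspace_valP : subspace_val \in subspace_pred subS }.

HB.instance Definition _ := [isSub for subspace_val].
HB.instance Definition _ := [Choice of subspace_type by <:].
HB.instance Definition _ := [SubChoice_isSubLmodule of subspace_type by <:].

Lemma subspace_val_in (u : subspace_type) : S (val u).
Proof. by have /asboolP := valP u. Qed.

Definition subspace_insub v (Sv : S v) : subspace_type :=
  SubspaceType (introT (asboolP (S v)) Sv).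

Lemma subspace_valB (u v : subspace_type) : val (u - v) = val u - val v.
Proof. exact: raddfB. Qed.

Lemma subspace_valZ a (u : subspace_type) : val (a *: u) = a *: val u.
Proof. exact: linearZ. Qed.

Lemma subspace_valP2 a (u v : subspace_type) : val (a *: u + v) = a *: val u + val v.
Proof. exact: linearP. Qed.

End SubspaceType.

(** The form needed for endomorphisms of H, which is only a predicate on V: [T] is controlled on [S]
    alone, so everything is restricted to the type of [S] first. *)
Lemma dixmier_schur_sub (R : realType) (V : lmodType R[i]) (ops : (V -> V) -> Prop)
    (E : nat -> V -> V) (S : V -> Prop) (T : V -> V) :
  (forall f, ops f <-> exists n, f = E n) -> (forall f, ops f -> islin f) ->
  simple_sub ops S -> (forall v, S v -> S (T v)) ->
  (forall a x y, S x -> S y -> T (a *: x + y) = a *: T x + T y) ->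
  (forall f v, ops f -> S v -> T (f v) = f (T v)) ->
  exists a, forall v, S v -> T v = a *: v.
Proof.
move=> opsE ops_lin [[subS stS] [[w [Sw w0]] simS]] TS linT commT.
have ES n : ops (E n) by apply/opsE; exists n.
pose W := subspace_type subS.
have valW (u : W) := subspace_val_in u.
pose E' n (u : W) : W := subspace_insub subS (stS _ (ES n) _ (valW u)).
pose T' (u : W) : W := subspace_insub subS (TS _ (valW u)).
pose ops' := fun g : W -> W => exists n, g = E' n.
have lin' g : ops' g -> islin g.
  by move=> [n ->] a x y; apply: val_inj; rewrite !subspace_valP2; apply/ops_lin/ES.
have sim' : simple_mod ops'.
  split; first by split; [split|].
  split; first by exists (subspace_insub subS Sw); split=> // /(congr1 val).
  move=> P [[P0 PD] stP] _.
  pose Q v := exists2 u : W, P u & val u = v.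
  have [] := simS Q.
  - split; first split.
    + by exists 0.
    + move=> a _ _ [x Px <-] [y Py <-]; exists (a *: x + y); first exact: PD.
      exact: subspace_valP2.
    + move=> _ /opsE[n ->] _ [x Px <-]; exists (E' n x) => //.
      by apply: stP => //; exists n.
  - by move=> _ [x _ <-].
  - move=> Q0; left=> u Pu; apply: val_inj; apply: Q0.
    by exists u.
  - move=> QS; right=> u _; have [x Px xu] := QS _ (valW u).
    by rewrite -(val_inj xu).
have opsE' f : ops' f <-> exists n, f = E' n by [].
have linT' : islin T' by move=> a x y; apply: val_inj; rewrite !subspace_valP2; apply: linT.
have commT' f v : ops' f -> T' (f v) = f (T' v).
  by move=> [n ->]; apply: val_inj; apply: commT.
have [a Ta] := dixmier_schur opsE' lin' sim' linT' commT'.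
exists a => v Sv; have /(congr1 val) := Ta (subspace_insub subS Sv).
by rewrite subspace_valZ.
Qed.

(** * Sums over the integers *)

Section IntegerSums.
Variables (R : realType) (V : lmodType R[i]).
Implicit Types f g : int -> V.

Definition int_ball (N : nat) : seq int := [seq j%:Z - N%:Z | j <- iota 0 (2 * N).+1].

Lemma int_ball_uniq N : uniq (int_ball N).
Proof. by rewrite map_inj_uniq ?iota_uniq // => i j /addIr[]. Qed.

Lemma mem_int_ball N i : (i \in int_ball N) = (`|i| <= N)%N.
Proof.
apply/mapP/idP => [[j]|iN]; first by rewrite mem_iota => /andP[_ jN] ->; lia.
by exists (absz (i + N%:Z)%R); [rewrite mem_iota; lia|lia].
Qed.

Definition supported N f := forall i, (N < `|i|)%N -> f i = 0.

(** Summing over all integers makes shifts of the index free of cut-offs; a bound on the support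
    returns only to split a sum or to apply an operator to it. *)
Definition int_sum f : V := \sum_(i \in [set: int]%classic) f i.

Lemma int_sum_ball N f : supported N f -> int_sum f = \sum_(i <- int_ball N) f i.
Proof.
move=> fN; rewrite /int_sum (fsbigE (int_ball N)) ?int_ball_uniq //.
  by rewrite big_mkcond /=; apply: eq_bigr => i _; rewrite in_setT.
by move=> i _; rewrite mem_int_ball -ltnNge; apply: fN.
Qed.

Lemma int_sumE N f : supported N f ->
  int_sum f = \sum_(j < (2 * N).+1) f (j%:Z - N%:Z).
Proof.
move=> fN; rewrite (int_sum_ball fN) big_map -(subn0 (2 * N).+1) -/(index_iota _ _).
by rewrite big_mkord subn0.
Qed.

Lemma supported_leq N M f : (N <= M)%N -> supported N f -> supported M f.
Proof. by move=> leNM fN i leMi; apply: fN; apply: leq_ltn_trans leMi. Qed.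

Lemma eq_int_sum f g : f =1 g -> int_sum f = int_sum g.
Proof. by move/funext->. Qed.

Lemma int_sumD N M f g : supported N f -> supported M g ->
  int_sum (fun i => f i + g i) = int_sum f + int_sum g.
Proof.
move=> /(supported_leq (leq_maxl N M)) fN /(supported_leq (leq_maxr N M)) gM.
rewrite (int_sum_ball fN) (int_sum_ball gM) -big_split; apply: int_sum_ball => i iNM.
by rewrite fN // gM // addr0.
Qed.

Lemma int_sum_islin N f (h : V -> V) : islin h -> supported N f ->
  h (int_sum f) = int_sum (fun i => h (f i)).
Proof.
move=> lh fN; rewrite (int_sum_ball fN) islin_sum //; apply/esym/int_sum_ball => i Ni.
by rewrite fN // islin0.
Qed.

Lemma scale_islin (a : R[i]) : islin ( *:%R a : V -> V).
Proof. by move=> b x y; rewrite scalerDr !scalerA mulrC. Qed.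

Lemma int_sumZ N f a : supported N f -> int_sum (fun i => a *: f i) = a *: int_sum f.
Proof. by move=> fN; rewrite (int_sum_islin (scale_islin a) fN). Qed.

Lemma int_sum_single j f : (forall i, i != j -> f i = 0) -> int_sum f = f j.
Proof.
move=> fj; rewrite /int_sum (fsbigE [:: j]) //; first by rewrite big_mkcond big_seq1 in_setT.
by move=> i _; rewrite inE => /fj.
Qed.

Lemma int_sum_shift n f : int_sum (fun i => f (i + n)) = int_sum f.
Proof.
apply/esym/reindex_fsbigT; exists (fun i => i - n) => i; rewrite ?addrK ?subrK //.
Qed.

End IntegerSums.

Lemma sum_mul_subn (F : numFieldType) (N : nat) :
  \sum_(t < N) (t%:R * (N%:R - t%:R)) = (N%:R ^+ 3 - N%:R) / 6%:R :> F.
Proof.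
(* The range [M] is decoupled from the parameter [N] so that the induction leaves the summand fixed;
   the right side is [N] times the sum of [t], minus the sum of [t ^ 2]. *)
have E M : \sum_(t < M) (t%:R * (N%:R - t%:R)) =
    (N%:R * M%:R * (M%:R - 1) / 2%:R - (M%:R - 1) * M%:R * (2%:R * M%:R - 1) / 6%:R) :> F.
  elim: M => [|M IHM]; first by rewrite big_ord0; field.
  by rewrite big_ord_recr /= IHM -natr1; field.
by rewrite E; field.
Qed.

(** The factor [(i < n) - (i < 0)] is the signed indicator of the interval between 0 and [n]. It
    arises from comparing two normal orderings, and this sum is the origin of the cubic Virasoro
    cocycle. *)
Lemma int_sum_anomaly (R : realType) (V : lmodType R[i]) (n : int) (v : V) :
  int_sum (fun i : int => (i * (n - i) * ((i < n)%R%:R - (i < 0)%R%:R))%:~R *: v) =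
  ((n ^+ 3 - n)%:~R / 6%:R) *: v.
Proof.
rewrite (int_sumE (N := `|n|)) => [|i ni]; last first.
  have -> : (i < n) = (i < 0) by lia.
  by rewrite subrr mulr0 scale0r.
rewrite -scaler_suml; congr (_ *: _); pose N := `|n|%N.
pose f (j : nat) : R[i] := let i := j%:Z - N%:Z in
  (i * (n - i) * ((i < n)%R%:R - (i < 0)%R%:R))%:~R.
transitivity (\sum_(j < (2 * N).+1) f j) => //.
(* The window from [-N] to [N] is cut into its negative part, the part from 0 to [N - 1], and the
   end point [N]; only one of the first two parts survives, according to the sign of [n]. *)
have -> : \sum_(j < (2 * N).+1) f j = \sum_(j < N) f j + (\sum_(j < N) f (N + j)%N + f (2 * N)%N).
  by rewrite big_ord_recr /= mul2n -addnn big_split_ord /= addrA.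
have [nN|nN] : n = N%:Z \/ n = - N%:Z by rewrite /N; lia.
- rewrite big1 => [|j _]; last first.
    rewrite /f /= (_ : (_ < n) = true) 1?(_ : (_ < 0) = true) ?subrr ?mulr0 //.
      by have := ltn_ord j; lia.
    by have := ltn_ord j; lia.
  have -> : f (2 * N)%N = 0 by rewrite /f /= nN (_ : N%:Z - _ = 0) ?mulr0 ?mul0r //; lia.
  rewrite add0r addr0 nN rmorphB rmorphXn /= -sum_mul_subn; apply: eq_bigr => j _.
  rewrite /f /= nN (_ : (N + j)%N%:Z - N%:Z = j%:Z); last by lia.
  rewrite ltz_nat ltn_ord /= subr0 mulr1.
  by rewrite rmorphM rmorphB /=.
- rewrite (_ : \sum_(j < N) f (N + j)%N = 0); last first.
    rewrite big1 // => j _.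
    rewrite /f /= (_ : (_ < n) = false) 1?(_ : (_ < 0) = false) ?subrr ?mulr0 //; lia.
  have -> : f (2 * N)%N = 0.
    rewrite /f /= (_ : (_ < n) = false) 1?(_ : (_ < 0) = false) ?subrr ?mulr0 //; lia.
  rewrite !addr0 (_ : (n ^+ 3 - n)%:~R = - (N%:R ^+ 3 - N%:R) :> R[i]); last first.
    by rewrite nN rmorphB rmorphXn rmorphN /=; ring.
  rewrite mulNr -sum_mul_subn -sumrN; apply: eq_bigr => j _.
  have jN := ltn_ord j; rewrite /f /= nN.
  rewrite (_ : (_ < - _) = false) 1?(_ : (_ < 0) = true); try lia.
  rewrite (_ : _ * _ = - (j%:Z * (N%:Z - j%:Z))); last by rewrite /= mulr1n; ring.
  by rewrite rmorphN rmorphM rmorphB.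
Qed.

(** * Sugawara operators *)

Section Heisenberg.
Variables (R : realType) (V : lmodType R[i]) (I : int -> V -> V) (a : R[i]).
Local Notation C := R[i].
Hypothesis linI : forall n, islin (I n).
Hypothesis commI : forall n m v, I n (I m v) - I m (I n v) = (n%:~R * delta R n m * a) *: v.
Hypothesis restrI : forall v, exists N : nat, forall i : int, N%:Z <= i -> I i v = 0.

Lemma commIl n m v : I n (I m v) = I m (I n v) + (n%:~R * delta R n m * a) *: v.
Proof. by rewrite -(commI n m v) addrC subrK. Qed.

Lemma nord_islin p q : islin (nord I p q).
Proof. by move=> c x y; rewrite /nord; case: ifP => _; rewrite !linI. Qed.

Lemma nord_eq0 (N : nat) v p q : (forall i : int, N%:Z <= i -> I i v = 0) ->
  (N%:Z <= p) || (N%:Z <= q) -> nord I p q v = 0.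
Proof.
move=> vN pq; rewrite /nord; case: ifP => lt_pq.
  by rewrite (vN q) ?islin0 //; lia.
by rewrite (vN p) ?islin0 //; lia.
Qed.

Lemma deltaN (n m : int) : n <> - m -> delta R n m = 0.
Proof. by rewrite /delta => /eqP/negPf->. Qed.

Lemma deltaE n : delta R (- n) n = 1.
Proof. by rewrite /delta eqxx. Qed.

(** A swap has a cost only if [q = - p <= p], so [p >= 0], and [p = 0] costs nothing; hence the
    indicator of [0 < p], from which the anomaly grows. *)
Lemma nordE p q v :
  I p (I q v) = nord I p q v + (p%:~R * (0 < p)%R%:R * delta R p q * a) *: v.
Proof.
rewrite /nord; have [lt_pq|le_qp] := ltP p q.
  have [p0|p0] := ltP 0 p; last by rewrite mulr0 !mul0r scale0r addr0.
  by rewrite deltaN ?mulr0 ?mul0r ?scale0r ?addr0 //; lia.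
rewrite commIl; congr (_ + _ *: _); congr (_ * _).
have [pq|/eqP pq] := eqVneq p (- q); last by rewrite deltaN ?mulr0.
have [p0|p0] := ltP 0 p; first by rewrite mulr1n mulr1.
have -> : p = 0 by lia.
by rewrite mulr0z !mul0r.
Qed.

Lemma nord_commI p q m v : nord I p q (I m v) - I m (nord I p q v) =
  (q%:~R * delta R q m * a) *: I p v + (p%:~R * delta R p m * a) *: I q v.
Proof.
have II r s : I r (I s (I m v)) - I m (I r (I s v)) =
    (s%:~R * delta R s m * a) *: I r v + (r%:~R * delta R r m * a) *: I s v.
  rewrite (commIl s m) (islinD (linI r)) (islinZ (linI r)) (commIl r m).
  by rewrite addrAC (addrC (I m _)) addrK addrC.
by rewrite /nord; case: ifP => _; rewrite II // addrC.
Qed.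

Definition sugawara k v : V := int_sum (fun i => nord I (- i) (i + k) v).

Lemma nord_supported (N : nat) k v : (forall i : int, N%:Z <= i -> I i v = 0) ->
  supported (N + `|k|)%N (fun i => nord I (- i) (i + k) v).
Proof. by move=> vN i Ni; apply: (nord_eq0 vN); lia. Qed.

Lemma sugawaraE (N : nat) k v : (forall i : int, N%:Z <= i -> I i v = 0) ->
  sugawara k v = sug I k (N + `|k|)%N v.
Proof. by move=> vN; rewrite /sugawara (int_sumE (nord_supported vN)). Qed.

Lemma sugawara_islin k : islin (sugawara k).
Proof.
move=> c x y; have [N xN] := restrI x; have [M yM] := restrI y.
rewrite /sugawara -(int_sumZ _ (nord_supported xN)) -(int_sumD (N := N + `|k|) _ (nord_supported yM)).
  by apply: eq_int_sum => i; apply: nord_islin.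
by move=> i Ni; rewrite (nord_supported xN) // scaler0.
Qed.

(** Only the summands [i = m] and [i = - (m + k)] fail to commute with [I m], and each contributes
    [- m * a] times [I (m + k)]. *)
Lemma sugawara_commI k m v :
  sugawara k (I m v) - I m (sugawara k v) = (- 2%:R * m%:~R * a) *: I (m + k) v.
Proof.
have [N vN] := restrI v; have [M wM] := restrI (I m v).
have sN := nord_supported (k := k) vN; have sM := nord_supported (k := k) wM.
rewrite /sugawara (int_sum_islin (linI m) sN) -scaleN1r -(int_sumZ (N := N + `|k|)); last first.
  by move=> i /sN; rewrite /= => ->; rewrite islin0.
rewrite -(int_sumD (N := M + `|k|) (M := N + `|k|)) //; last first.
  by move=> i /sN; rewrite /= => ->; rewrite islin0 ?scaler0.
under eq_int_sum => i do rewrite scaleN1r nord_commI.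
rewrite (int_sumD (N := `|m + k|) (M := `|m|)).
- rewrite (int_sum_single (j := - (m + k))) => [|i ij]; last first.
    by rewrite deltaN ?mulr0 ?mul0r ?scale0r //; move/eqP in ij; lia.
  rewrite (int_sum_single (j := m)) => [|i ij]; last first.
    by rewrite deltaN ?mulr0 ?mul0r ?scale0r //; move/eqP in ij; lia.
  have -> : - (m + k) + k = - m by lia.
  rewrite !deltaE opprK -scalerDl; congr (_ *: _); rewrite !rmorphN /=; ring.
- by move=> i ik; rewrite deltaN ?mulr0 ?mul0r ?scale0r //; lia.
- by move=> i ik; rewrite deltaN ?mulr0 ?mul0r ?scale0r //; lia.
Qed.

Lemma sugawara_commIl k m v :
  sugawara k (I m v) = I m (sugawara k v) + (- 2%:R * m%:~R * a) *: I (m + k) v.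
Proof. by rewrite -sugawara_commI addrC subrK. Qed.

(** The two indices of each summand add up to [k >= 2 N], so one of them is at least [N]. As all
    summands vanish, the sum equals the one at 0. *)
Lemma sugawara_eq0 (N : nat) k v : (forall i : int, N%:Z <= i -> I i v = 0) ->
  (2 * N)%:Z <= k -> sugawara k v = 0.
Proof.
move=> vN Nk; rewrite /sugawara (int_sum_single (j := 0)) => [|i _].
  by apply: nord_eq0 vN _; lia.
by apply: nord_eq0 vN _; lia.
Qed.

(** Normal ordering changes a product by a scalar, which drops out of the commutator; the derivation
    rule is then applied to the plain product. *)
Lemma sugawara_comm_nord n p q v :
  sugawara n (nord I p q v) - nord I p q (sugawara n v) =
  (- 2%:R * q%:~R * a) *: I p (I (q + n) v) + (- 2%:R * p%:~R * a) *: I (p + n) (I q v).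
Proof.
have nordD w : nord I p q w = I p (I q w) + (- (p%:~R * (0 < p)%R%:R * delta R p q * a)) *: w.
  by rewrite nordE scaleNr addrK.
have linS := sugawara_islin n.
rewrite !nordD (islinD linS) (islinZ linS) opprD addrACA subrr addr0.
rewrite !sugawara_commIl (islinD (linI p)) (islinZ (linI p)).
by rewrite addrAC (addrAC _ _ (- _)) subrr add0r.
Qed.

(* The commutator of a Sugawara operator with one normally ordered product;
   the anomaly is the last term. *)
Lemma sugawara_comm_summand n m i v :
  sugawara n (nord I (- i) (i + m) v) - nord I (- i) (i + m) (sugawara n v) =
  (- 2%:R * (i + m)%:~R * a) *: nord I (- i) (i + (n + m)) v
  + (2%:R * i%:~R * a) *: nord I (n - i) (i + m) v
  + (2%:R * a ^+ 2 * delta R n m)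
    *: ((i * (n - i) * ((i < n)%R%:R - (i < 0)%R%:R))%:~R *: v).
Proof.
have delta1 : delta R (- i) (i + m + n) = delta R n m.
  by rewrite /delta; congr (if _ then _ else _); apply/eqP/eqP => ?; lia.
have delta2 : delta R (- i + n) (i + m) = delta R n m.
  by rewrite /delta; congr (if _ then _ else _); apply/eqP/eqP => ?; lia.
rewrite sugawara_comm_nord !nordE delta1 delta2.
rewrite (_ : i + m + n = i + (n + m)); last by lia.
rewrite (_ : - i + n = n - i); last by lia.
rewrite !scalerDr !scalerA addrACA; congr (_ + _ + _).
  by congr (_ *: _); rewrite rmorphN /=; ring.
rewrite -scalerDl; congr (_ *: _).
rewrite oppr_gt0 subr_gt0 /delta; case: eqP => [->|_]; last by rewrite !(mulr0, mul0r) addr0.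
by rewrite !(rmorphM, rmorphD, rmorphN, rmorph_nat) /= ; ring.
Qed.

(** The summands must be normally ordered before the sum is split: when [n + m = 0] the plain
    products need not have finite support separately. *)
Lemma sugawara_comm n m v :
  sugawara n (sugawara m v) - sugawara m (sugawara n v) =
  (2%:R * (n - m)%:~R * a) *: sugawara (n + m) v
  + (2%:R * a ^+ 2 * delta R n m * ((n ^+ 3 - n)%:~R / 6%:R)) *: v.
Proof.
have [N vN] := restrI v; have [M wM] := restrI (sugawara n v).
have sN := nord_supported (k := m) vN; have sM := nord_supported (k := m) wM.
have sNm := nord_supported (k := n + m) vN.
rewrite {2 3}/sugawara (int_sum_islin (sugawara_islin n) sN) -scaleN1r -(int_sumZ _ sM).
rewrite -(int_sumD (N := N + `|m|) (M := M + `|m|)); first last.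
- by move=> i /sM /= ->; rewrite scaler0.
- by move=> i /sN /= ->; apply/islin0/sugawara_islin.
under eq_int_sum => i do rewrite scaleN1r sugawara_comm_summand -addrA.
pose A i := (- 2%:R * (i + m)%:~R * a) *: nord I (- i) (i + (n + m)) v.
pose B i := (2%:R * i%:~R * a) *: nord I (n - i) (i + m) v.
have sA : supported (N + `|n + m|) A by move=> i /sNm /= Ai; rewrite /A Ai scaler0.
have sB : supported (N + `|n| + `|m|) B.
  by move=> i Ni; rewrite /B (nord_eq0 vN) ?scaler0 //; lia.
have sD : supported `|n| (fun i => (2%:R * a ^+ 2 * delta R n m) *:
    ((i * (n - i) * ((i < n)%R%:R - (i < 0)%R%:R))%:~R *: v)).
  by move=> i ni; rewrite (_ : (i < n) = (i < 0)) ?subrr ?mulr0 ?scale0r ?scaler0 //; lia.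
have sBD : supported (N + `|n| + `|m|) (fun i => B i + (2%:R * a ^+ 2 * delta R n m) *:
    ((i * (n - i) * ((i < n)%R%:R - (i < 0)%R%:R))%:~R *: v)).
  by move=> i Ni; rewrite sB // sD ?addr0 //; lia.
rewrite (int_sumD sA sBD) (int_sumD sB sD) addrA; congr (_ + _); last first.
  rewrite (int_sumZ (N := `|n|)) ?int_sum_anomaly ?scalerA // => i ni.
  by rewrite (_ : (i < n) = (i < 0)) ?subrr ?mulr0 ?scale0r //; lia.
(* The shift by [n] gives [B] the same products as [A], and the coefficients add up:
   [-2 (i + m) + 2 (i + n) = 2 (n - m)]. *)
rewrite -(int_sum_shift n B) -(int_sumD sA (M := N + `|n| + `|m| + `|n|)); last first.
  by move=> i Ni; apply: sB; lia.
rewrite -(int_sumZ _ sNm); apply: eq_int_sum => i.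
rewrite /A /B (_ : n - (i + n) = - i) 1?(_ : i + n + m = i + (n + m)); try lia.
by rewrite -scalerDl; congr (_ *: _); rewrite !(rmorphD, rmorphB) /=; ring.
Qed.

Variable b : C.
Hypothesis a_neq0 : a != 0.

(** The Feigin-Fuchs modification: since [[I k, I m]] is [k * a] for [m = - k], the linear term
    yields exactly the cocycle [(k ^ 2 + k) * b]. *)
Definition twisted_sugawara k v : V :=
  (- (2%:R * a)^-1) *: sugawara k v + (((k + 1)%:~R * b) / a) *: I k v.

Lemma twisted_sugawaraE (N : nat) k v : (forall i : int, N%:Z <= i -> I i v = 0) ->
  twisted_sugawara k v = Hd I a b k (N + `|k|)%N v.
Proof. by move=> vN; rewrite /twisted_sugawara (sugawaraE _ vN). Qed.

Lemma twisted_sugawara_islin k : islin (twisted_sugawara k).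
Proof.
move=> c x y; rewrite /twisted_sugawara sugawara_islin linI !scalerDr !scalerA.
by rewrite addrACA ![_ * c]mulrC.
Qed.

Lemma twisted_sugawara_eq0 (N : nat) k v : (forall i : int, N%:Z <= i -> I i v = 0) ->
  (2 * N)%:Z <= k -> twisted_sugawara k v = 0.
Proof.
move=> vN Nk; rewrite /twisted_sugawara (sugawara_eq0 vN) // vN ?scaler0 ?addr0 //.
by clear -Nk; lia.
Qed.

Lemma twisted_sugawara_commI k m v :
  twisted_sugawara k (I m v) - I m (twisted_sugawara k v) =
  m%:~R *: I (m + k) v + (delta R k m * (k ^+ 2 + k)%:~R) *: (b *: v).
Proof.
rewrite /twisted_sugawara (islinD (linI m)) !(islinZ (linI m)) sugawara_commIl.
rewrite commIl !scalerDr !scalerA addrACA [LHS]addrC addKr.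
congr (_ *: _ + _ *: _); first by field.
by rewrite !(rmorphD, rmorphXn) /=; field.
Qed.

(** The quadratic part has central charge 1. The linear parts contribute
    [n (n + 1) (1 - n) b ^ 2 / a], that is [-12 b ^ 2 / a] to the charge, and the mixed brackets
    recombine through [m (m + 1) - n (n + 1) = (m - n) (m + n + 1)]. *)
Lemma twisted_sugawara_comm n m v :
  twisted_sugawara n (twisted_sugawara m v) - twisted_sugawara m (twisted_sugawara n v) =
  (m - n)%:~R *: twisted_sugawara (n + m) v +
  (delta R n m * ((n ^+ 3 - n)%:~R / 12%:R)) *: ((1 - 12%:R * b ^+ 2 / a) *: v).
Proof.
pose S := sugawara.
have linS k : islin (S k) := sugawara_islin k.
pose al : C := - (2%:R * a)^-1; pose be k : C := ((k + 1)%:~R * b) / a.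
have E k w : twisted_sugawara k w = al *: S k w + be k *: I k w by [].
have X : twisted_sugawara n (twisted_sugawara m v) - twisted_sugawara m (twisted_sugawara n v) =
   al ^+ 2 *: (S n (S m v) - S m (S n v)) + (al * be m) *: (S n (I m v) - I m (S n v))
   - (al * be n) *: (S m (I n v) - I n (S m v)) + (be n * be m) *: (I n (I m v) - I m (I n v)).
  rewrite !E !(islinD (linS _), islinZ (linS _), islinD (linI _), islinZ (linI _)).
  rewrite !(scalerDr, scalerN, scalerA) !(opprD, opprK) (mulrC (be m) al) (mulrC (be n) al).
  rewrite -[al ^+ 2]/(al * al) (mulrC (be m) (be n)).
  by rewrite (AC ((2*2)*(2*2)) ((1*5)*(2*7)*(6*3)*(4*8))).
rewrite X sugawara_comm !sugawara_commI // commI E !scalerDr !scalerA (addrC m n).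
rewrite (AC (2*1*1*1) (1*(3*4)*(2*5))) /= -scalerBl -scalerDl.
congr (_ *: _ + _ *: _ + _ *: _); rewrite /al /be.
- by rewrite !rmorphB /=; field.
- by rewrite !(rmorphB, rmorphD) /=; field.
rewrite /delta; case: eqP => [->|_]; last by rewrite !(mulr0, mul0r) addr0.
by rewrite !(rmorphB, rmorphXn, rmorphD, rmorphN) /=; field.
Qed.

Lemma commute_twisted_sugawara (T : V -> V) k v : islin T ->
  (forall m w, T (I m w) = I m (T w)) ->
  T (twisted_sugawara k v) = twisted_sugawara k (T v).
Proof.
move=> linT commT; have [N vN] := restrI v.
rewrite /twisted_sugawara (islinD linT) !(islinZ linT) commT; congr (_ *: _ + _).
rewrite /sugawara (int_sum_islin linT (nord_supported vN)); apply: eq_int_sum => i.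
by rewrite /nord; case: ifP => _; rewrite !commT.
Qed.

End Heisenberg.

(** * Isotypic decomposition *)

Section Isotypic.
Variables (R : realType) (V : lmodType R[i]) (ops : (V -> V) -> Prop).
Variables (E : nat -> V -> V) (H : V -> Prop) (h0 : V).
Local Notation C := R[i].
Hypothesis opsE : forall f, ops f <-> exists n, f = E n.
Hypothesis ops_lin : forall f, ops f -> islin f.
Hypothesis simpleH : simple_sub ops H.
Hypothesis Hh0 : H h0.
Hypothesis h0_neq0 : h0 <> 0.

(** Total functions constrained on [H] only: those that agree on [H] stand for the same
    homomorphism. *)
Definition is_hom (phi : V -> V) :=
  (forall a x y, H x -> H y -> phi (a *: x + y) = a *: phi x + phi y) /\
  (forall f x, ops f -> H x -> phi (f x) = f (phi x)).

Let subH : subspace H. Proof. by case: simpleH => -[]. Qed.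
Let stabH f x : ops f -> H x -> H (f x).
Proof. by case: simpleH => -[_ st] _ opsf; apply: st. Qed.

Lemma H_full (K : V -> Prop) x : submodule ops K -> (forall y, K y -> H y) ->
  K x -> x <> 0 -> forall y, H y -> K y.
Proof.
move=> subK KH Kx x0; have [_ [_ /(_ K subK KH)[K0|//]]] := simpleH.
by have := K0 x Kx.
Qed.

Lemma is_hom_comb a phi psi : is_hom phi -> is_hom psi ->
  is_hom (fun x => a *: phi x + psi x).
Proof.
move=> [lp cp] [lq cq]; split=> [b x y Hx Hy|f x opsf Hx].
  by rewrite lp // lq // !scalerDr !scalerA mulrC addrACA.
by rewrite cp // cq // (ops_lin opsf).
Qed.

Lemma is_hom0 : is_hom (fun _ => 0).
Proof.
split=> [a x y _ _|f x opsf _]; first by rewrite scaler0 addr0.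
exact/esym/islin0/ops_lin.
Qed.

Lemma is_hom_post T phi : islin T -> (forall f x, ops f -> T (f x) = f (T x)) ->
  is_hom phi -> is_hom (fun x => T (phi x)).
Proof.
move=> linT commT [lp cp]; split=> [a x y Hx Hy|f x opsf Hx].
  by rewrite lp // linT.
by rewrite cp // commT.
Qed.

Lemma hom_at0 phi : is_hom phi -> phi 0 = 0.
Proof.
move=> [lp _]; have H0 := subspace0 subH.
by have := lp (-1) 0 0 H0 H0; rewrite scaler0 addr0 scaleN1r addNr.
Qed.

Lemma homD phi x y : is_hom phi -> H x -> H y -> phi (x + y) = phi x + phi y.
Proof. by move=> [lp _] Hx Hy; rewrite -[x in LHS]scale1r lp // scale1r. Qed.

Lemma homZ phi a x : is_hom phi -> H x -> phi (a *: x) = a *: phi x.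
Proof.
move=> hp Hx; rewrite -[_ *: x]addr0 hp.1 ?(hom_at0 hp) ?addr0 //.
exact: subspace0 subH.
Qed.

Lemma hom_bigsum phi (J : Type) (r : seq J) (F : J -> V) : is_hom phi ->
  (forall j, H (F j)) -> phi (\sum_(j <- r) F j) = \sum_(j <- r) phi (F j).
Proof.
move=> hp HF; elim: r => [|j r IHr]; first by rewrite !big_nil hom_at0.
by rewrite !big_cons homD // ?IHr //; apply: (subspace_sum subH).
Qed.

Lemma hom_eq0 phi x : is_hom phi -> H x -> x <> 0 -> phi x = 0 ->
  forall y, H y -> phi y = 0.
Proof.
move=> hp Hx x0 px y Hy.
suff [] : H y /\ phi y = 0 by [].
apply: (H_full (K := fun y => H y /\ phi y = 0) (x := x)) Hy => //; last by move=> ? [].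
have H0 := subspace0 subH; split; first split.
- by rewrite hom_at0.
- move=> a u v [Hu pu] [Hv pv]; rewrite hp.1 // pu pv scaler0 addr0; split=> //.
  by apply: (subspaceD subH) => //; apply: (subspaceZ subH).
- move=> f opsf u [Hu pu]; rewrite hp.2 // pu islin0; last exact: ops_lin.
  by split=> //; apply: stabH.
Qed.

Lemma hom_unique phi psi : is_hom phi -> is_hom psi -> phi h0 = psi h0 ->
  forall x, H x -> phi x = psi x.
Proof.
move=> hp hq pq x Hx; apply/eqP; rewrite -subr_eq0 -scaleN1r addrC; apply/eqP.
apply: (hom_eq0 (is_hom_comb (-1) hq hp) Hh0) => //.
by rewrite pq scaleN1r addNr.
Qed.

(* A homomorphism [H -> V] is encoded by its value at [h0]. *)
Definition multiplicity (v : V) := exists phi, is_hom phi /\ phi h0 = v.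

Definition hom_of (u h : V) : V :=
  if pselect (multiplicity u) is left Uu then projT1 (cid Uu) h else 0.

Lemma hom_ofP u : multiplicity u -> is_hom (hom_of u) /\ hom_of u h0 = u.
Proof. by move=> Uu; rewrite /hom_of; case: pselect => // Uu'; case: (cid Uu'). Qed.

Lemma hom_ofE phi h : is_hom phi -> H h -> hom_of (phi h0) h = phi h.
Proof.
move=> hp Hh; have [|hq q] := @hom_ofP (phi h0); first by exists phi.
exact: hom_unique Hh.
Qed.

Lemma multiplicity_subspace : subspace multiplicity.
Proof.
split=> [|a _ _ [phi [hp <-]] [psi [hq <-]]]; first by exists (fun _ => 0); split=> //; apply: is_hom0.
by exists (fun x => a *: phi x + psi x); split=> //; apply: is_hom_comb.
Qed.

Lemma multiplicity_stable T u : islin T -> (forall f x, ops f -> T (f x) = f (T x)) ->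
  multiplicity u -> multiplicity (T u).
Proof.
move=> linT commT [phi [hp <-]]; exists (fun x => T (phi x)); split=> //.
exact: is_hom_post.
Qed.

Lemma hom_of_post T u h : islin T -> (forall f x, ops f -> T (f x) = f (T x)) ->
  multiplicity u -> H h -> hom_of (T u) h = T (hom_of u h).
Proof.
move=> linT commT /hom_ofP[hp p0] Hh.
by rewrite -(hom_ofE (is_hom_post linT commT hp) Hh) p0.
Qed.

Lemma hom_of_comb a u v h : multiplicity u -> multiplicity v -> H h ->
  hom_of (a *: u + v) h = a *: hom_of u h + hom_of v h.
Proof.
move=> /hom_ofP[hp p0] /hom_ofP[hq q0] Hh.
by rewrite -(hom_ofE (is_hom_comb a hp hq) Hh) p0 q0.
Qed.

Lemma hom_of0 h : H h -> hom_of 0 h = 0.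
Proof. exact: (hom_ofE is_hom0). Qed.

(** The sum of the images of the homomorphisms encoded by [us]; recursion on the list lets the
    independence proof discard one head at a time. *)
Fixpoint hom_span (us : seq V) (v : V) : Prop :=
  if us is u :: us' then exists2 h, H h & hom_span us' (v - hom_of u h) else v = 0.

Fixpoint lin_span (us : seq V) (v : V) : Prop :=
  if us is u :: us' then exists c : C, lin_span us' (v - c *: u) else v = 0.

Lemma lin_span_cons u us v : lin_span us v -> lin_span (u :: us) v.
Proof. by exists 0; rewrite scale0r subr0. Qed.

Fixpoint all_mult (us : seq V) : Prop :=
  if us is u :: us' then multiplicity u /\ all_mult us' else True.

Lemma hom_span_submodule us : all_mult us -> submodule ops (hom_span us).
Proof.
elim: us => [_|u us IHus /= [Uu /IHus[[M0 ML] Mst]]].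
  split; first by split=> // a x y /= -> ->; rewrite scaler0 addr0.
  by move=> f opsf v /= ->; apply/islin0/ops_lin.
have [hu _] := hom_ofP Uu; split; first split.
- by exists 0; rewrite ?(hom_at0 hu) ?subr0 //; apply: (subspace0 subH).
- move=> a x y [h Hh xh] [k Hk yk]; exists (a *: h + k).
    by apply: subH.2.
  rewrite hu.1 // opprD addrACA -scalerBr; exact: ML.
- move=> f opsf v [h Hh vh]; exists (f h); first exact: stabH.
  by rewrite hu.2 // -(islinB (ops_lin opsf)); apply: Mst.
Qed.

Lemma lin_span_hom_span us u h : all_mult us -> multiplicity u -> H h ->
  lin_span us u -> hom_span us (hom_of u h).
Proof.
elim: us u => [|u1 us IHus] u /=; first by move=> _ _ Hh ->; rewrite hom_of0.
move=> [U1 Us] Uu Hh [c uc]; have [h1 _] := hom_ofP U1.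
exists (c *: h); first exact: (subspaceZ subH).
rewrite (homZ _ h1) // -scaleNr addrC -hom_of_comb // scaleNr addrC; apply: IHus => //.
by apply: (subspaceB multiplicity_subspace) => //; apply: (subspaceZ multiplicity_subspace).
Qed.

(* If [u1] is not in the span of [us], a relation exhibiting part of
   [hom_of u] inside [hom_span (u1 :: us)] determines an endomorphism of [H],
   which is a scalar by Dixmier's lemma. *)
Lemma hom_span_lin_span us u h : all_mult us -> multiplicity u -> H h -> h <> 0 ->
  hom_span us (hom_of u h) -> lin_span us u.
Proof.
elim: us u h => [|u1 us IHus] u h.
  move=> _ /hom_ofP[hu u0] Hh hn0 /= uh; rewrite -u0.
  exact: (hom_eq0 hu Hh).
move=> [U1 Us] Uu Hh hn0 [k Hk Mhk].
have Msub := hom_span_submodule Us; have [[M0 ML] Mst] := Msub.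
have [hu hu0] := hom_ofP Uu; have [h1 h10] := hom_ofP U1.
(* A redundant [u1] is dropped, since its image already lies in [hom_span us]. Otherwise the
   induction hypothesis for [u1] makes the partner [y] of each [x] unique, which is what turns the
   chosen [T] into a linear map. *)
have [sp1|nsp1] := pselect (lin_span us u1).
  apply: lin_span_cons; apply: (IHus u h) => //.
  rewrite -(subrK (hom_of u1 k) (hom_of u h)).
  by apply: (subspaceD Msub.1) => //; apply: lin_span_hom_span.
have uniq y : H y -> hom_span us (hom_of u1 y) -> y = 0.
  by move=> Hy My; apply: contrapT => y0; apply/nsp1/(IHus u1 y).
pose K x := H x /\ exists2 y, H y & hom_span us (hom_of u x - hom_of u1 y).
have comb a x x' y y' : H x -> H x' -> H y -> H y' ->
    hom_span us (hom_of u x - hom_of u1 y) -> hom_span us (hom_of u x' - hom_of u1 y') ->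
    hom_span us (hom_of u (a *: x + x') - hom_of u1 (a *: y + y')).
  by move=> *; rewrite hu.1 // h1.1 // opprD addrACA -scalerBr; apply: ML.
have opcomb f x y : ops f -> H x -> H y ->
    hom_span us (hom_of u x - hom_of u1 y) -> hom_span us (hom_of u (f x) - hom_of u1 (f y)).
  by move=> opsf *; rewrite hu.2 // h1.2 // -(islinB (ops_lin opsf)); apply: Mst.
have HK : forall x, H x -> K x.
  apply: (H_full (x := h)) => //; [|by move=> ? []|by split=> //; exists k].
  have H0 := subspace0 subH; split; first split.
  - by split=> //; exists 0; rewrite // (hom_at0 hu) (hom_at0 h1) subr0.
  - move=> a x x' [Hx [y Hy xy]] [Hx' [y' Hy' xy']]; split; first exact: subH.2.
    by exists (a *: y + y'); [apply: subH.2|apply: comb].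
  - move=> f opsf x [Hx [y Hy xy]]; split; first exact: stabH.
    by exists (f y); [apply: stabH|apply: opcomb].
have /choice[T TP] : forall x, exists y, H x -> H y /\ hom_span us (hom_of u x - hom_of u1 y).
  move=> x; have [Hx|nHx] := pselect (H x); last by exists 0.
  by have [_ [y Hy xy]] := HK x Hx; exists y.
have Tuniq x y : H x -> H y -> hom_span us (hom_of u x - hom_of u1 y) -> T x = y.
  move=> Hx Hy xy; have [HT xT] := TP x Hx; apply/eqP; rewrite -subr_eq0; apply/eqP.
  have HTy := subspaceB subH HT Hy; apply: uniq => //.
  have := subspaceB Msub.1 xy xT; rewrite opprB addrC addrA subrK.
  by rewrite -[T x - y]addrC -[- y]scaleN1r h1.1 // scaleN1r addrC.
have [lam Tlam] : exists lam, forall x, H x -> T x = lam *: x.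
  apply: (dixmier_schur_sub opsE ops_lin simpleH).
  - by move=> x /TP[].
  - move=> a x y Hx Hy; have [HTx xT] := TP x Hx; have [HTy yT] := TP y Hy.
    by apply: Tuniq; [apply: subH.2|apply: subH.2|apply: comb].
  - move=> f x opsf Hx; have [HTx xT] := TP x Hx.
    by apply: Tuniq; [apply: stabH|apply: stabH|apply: opcomb].
exists lam; apply: (IHus _ h) => //.
  by apply: (subspaceB multiplicity_subspace) => //; apply: (subspaceZ multiplicity_subspace).
have [_] := TP h Hh; rewrite Tlam // (homZ _ h1) // -scaleNr addrC -hom_of_comb //.
by rewrite scaleNr addrC.
Qed.

(** * The evaluation map on H (x) U *)

Definition multiplicity_space := subspace_type multiplicity_subspace.
Local Notation W := multiplicity_space.

Definition tensor_map (h : V) (u : W) : V := hom_of (val u) h.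
Definition tensor_sum (s : seq (V * W)) : V := \sum_(p <- s) tensor_map p.1 p.2.
Definition left_in (s : seq (V * W)) := forall p, p \in s -> H p.1.
Definition right_vectors (s : seq (V * W)) : seq V := [seq val p.2 | p <- s].

Lemma tensor_map_hom (u : W) : is_hom (tensor_map^~ u).
Proof. by have [] := hom_ofP (subspace_val_in u). Qed.

Lemma tensor_map_linr a h (u v : W) : H h ->
  tensor_map h (a *: u + v) = a *: tensor_map h u + tensor_map h v.
Proof.
move=> Hh; rewrite /tensor_map subspace_valP2.
by apply: hom_of_comb => //; apply: subspace_val_in.
Qed.

Lemma tensor_map_h0 (u : W) : tensor_map h0 u = val u.
Proof. by have [] := hom_ofP (subspace_val_in u). Qed.

Lemma all_mult_right s : all_mult (right_vectors s).
Proof. by elim: s => //= p s IHs; split=> //; apply: subspace_val_in. Qed.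

Lemma left_in_cons p s : left_in (p :: s) -> H p.1 /\ left_in s.
Proof.
move=> Hs; split=> [|q qs]; first by apply: Hs; rewrite mem_head.
by apply: Hs; rewrite in_cons qs orbT.
Qed.

Lemma tensor_sum_hom_span s : left_in s -> hom_span (right_vectors s) (tensor_sum s).
Proof.
elim: s => [_|p s IHs /left_in_cons[Hp Hs]]; first by rewrite /tensor_sum big_nil.
exists p.1 => //; rewrite /tensor_sum big_cons /tensor_map [X in X - _]addrC addrK; exact: IHs.
Qed.

Lemma right_span_closed (S : W -> Prop) s (u : W) : subspace S ->
  (forall p, p \in s -> S p.2) -> lin_span (right_vectors s) (val u) -> S u.
Proof.
move=> subS; elim: s u => [|p s IHs] u Ss /=.
  by move=> u0; have -> : u = 0 by [apply: val_inj]; apply: (subspace0 subS).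
move=> [c]; rewrite -scaleNr addrC -subspace_valP2 => /IHs Su.
rewrite -(addKr (- c *: p.2) u) -scaleNr opprK addrC.
apply: (subspaceD subS).
  by apply: Su => q qs; apply: Ss; rewrite in_cons qs orbT.
by apply/(subspaceZ subS)/Ss; rewrite mem_head.
Qed.

Lemma islinf0 (U : lmodType C) (f : U -> C) : islinf f -> f 0 = 0.
Proof. by move=> lf; have := lf (-1) 0 0; rewrite scaler0 addr0 mulN1r addNr. Qed.

(** If [u] is a combination of the right factors with coefficients [c_i], the term [h (x) u] is
    absorbed by replacing each left factor [h_i] with [h_i + c_i h]. The length does not grow, which
    drives the induction for injectivity. *)
Lemma tensor_absorb s (u : W) h : left_in s -> H h ->
  lin_span (right_vectors s) (val u) ->
  exists s', [/\ size s' = size s, left_in s', tensor_sum s' = tensor_map h u + tensor_sum s &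
    forall (f : V -> C) (g : W -> C), islinf f -> islinf g ->
      \sum_(p <- s') f p.1 * g p.2 = f h * g u + \sum_(p <- s) f p.1 * g p.2].
Proof.
elim: s u => [|[k w] s IHs] u /=.
  move=> _ Hh u0; have -> : u = 0 by apply: val_inj.
  exists [::]; split=> // [|f g lf lg].
    by rewrite /tensor_sum big_nil /tensor_map hom_of0 // addr0.
  by rewrite !big_nil (islinf0 lg) mulr0 addr0.
move=> /left_in_cons[/= Hk Hs] Hh [c]; rewrite -scaleNr addrC -subspace_valP2.
move=> /(IHs _ Hs Hh)[s' [sz Hs' sumE fgE]].
exists ((k + c *: h, w) :: s'); split=> [||| f g lf lg].
- by rewrite /= sz.
- move=> p; rewrite in_cons => /predU1P[->|/Hs'//] /=.
  by apply: (subspaceD subH) => //; apply: (subspaceZ subH).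
- rewrite /tensor_sum !big_cons /= -!/(tensor_sum _) sumE tensor_map_linr //.
  rewrite addrC [k + _]addrC (tensor_map_hom w).1 // scaleNr.
  by rewrite (AC ((2*1)*2) (2*(5*3)*(4*1))) /= subrr addr0.
- by rewrite !big_cons /= fgE // [k + _]addrC lf lg; ring.
Qed.

(** In a vanishing sum with [h] nonzero, independence puts [u] in the span of the other right
    factors; absorbing the head leaves a shorter vanishing sum that represents the same tensor. *)
Lemma tensor_map_inj s : left_in s -> tensor_sum s = 0 ->
  forall (f : V -> C) (g : W -> C), islinf f -> islinf g ->
    \sum_(p <- s) f p.1 * g p.2 = 0.
Proof.
have [n] := ubnP (size s); elim: n s => // n IHn [|[h u] s] /= sz Hs s0 f g lf lg.
  by rewrite big_nil.
have [/= Hh Hs'] := left_in_cons Hs; move: s0.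
rewrite /tensor_sum !big_cons /= => s0.
have [h_eq0|h_neq0] := pselect (h = 0).
  rewrite h_eq0 (islinf0 lf) mul0r add0r; apply: IHn => //.
  by rewrite -{}[RHS]s0 h_eq0 (hom_at0 (tensor_map_hom u)) add0r.
have : lin_span (right_vectors s) (val u).
  have am := all_mult_right s.
  apply: (hom_span_lin_span am (subspace_val_in u) Hh h_neq0).
  have /eqP := s0; rewrite addr_eq0 => /eqP; rewrite -[hom_of _ _]/(tensor_map h u) => ->; rewrite -scaleN1r.
  by apply: (subspaceZ (hom_span_submodule am).1); apply: tensor_sum_hom_span.
move=> /(tensor_absorb Hs' Hh)[s' [sz' Hs'' sumE fgE]].
by rewrite -fgE //; apply: IHn => //; rewrite ?sz' // sumE.
Qed.

Definition tensor_image (S : W -> Prop) (v : V) :=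
  exists2 s, left_in s /\ (forall p, p \in s -> S p.2) & v = tensor_sum s.

Lemma tensor_image_pure (S : W -> Prop) h u : H h -> S u -> tensor_image S (tensor_map h u).
Proof.
move=> Hh Su; exists [:: (h, u)]; last by rewrite /tensor_sum big_seq1.
by split=> p; rewrite inE => /eqP->.
Qed.

Lemma tensor_image_subspace S : subspace (tensor_image S).
Proof.
have scale a s : left_in s -> tensor_sum [seq (a *: p.1, p.2) | p <- s] = a *: tensor_sum s.
  rewrite /tensor_sum big_map scaler_sumr => Hs; rewrite !big_seq.
  by apply: eq_bigr => p /Hs Hp /=; rewrite (homZ _ (tensor_map_hom _)).
split=> [|a _ _ [s [Hs Ss] ->] [t [Ht St] ->]].
  by exists [::]; [split|rewrite /tensor_sum big_nil].
exists ([seq (a *: p.1, p.2) | p <- s] ++ t); last first.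
  by rewrite {3}/tensor_sum big_cat /= -!/(tensor_sum _) scale.
split=> p; rewrite mem_cat => /orP[/mapP[q qs ->] /=|pt].
- by apply: (subspaceZ subH); apply: Hs.
- exact: Ht.
- exact: Ss.
- exact: St.
Qed.

Lemma tensor_image_stable S (T : V -> V) : islin T ->
  (forall h u, H h -> S u -> tensor_image S (T (tensor_map h u))) ->
  forall v, tensor_image S v -> tensor_image S (T v).
Proof.
move=> linT ST _ [s [Hs Ss] ->]; rewrite /tensor_sum islin_sum // big_seq.
apply: (subspace_sum (tensor_image_subspace S)) => p ps.
by apply: ST; [apply: Hs|apply: Ss].
Qed.

(** Recovers [S] from the image of H (x) S: [u] is the image of [h0 (x) u], so independence places
    it in the span of right factors taken from [S]. *)
Lemma tensor_image_mem S (u : W) : subspace S -> tensor_image S (val u) -> S u.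
Proof.
move=> subS [s [Hs Ss] us]; apply: (right_span_closed subS Ss).
apply: (hom_span_lin_span (all_mult_right s) (subspace_val_in u) Hh0 h0_neq0).
by rewrite -/(tensor_map h0 u) tensor_map_h0 us; apply: tensor_sum_hom_span.
Qed.

(** The inclusion of [H] in V shows that the multiplicity space is nonzero. *)
Lemma multiplicity_h0 : multiplicity h0.
Proof. by exists id; split. Qed.

End Isotypic.

(** * The Heisenberg-Virasoro algebra *)

Lemma countType_enum (A : Type) (T : countType) (t0 : T) (F : T -> A) (P : A -> Prop) :
  (forall f, P f <-> exists t, f = F t) ->
  forall f, P f <-> exists n, f = F (odflt t0 (unpickle n)).
Proof.
move=> PF f; rewrite PF; split=> [[t ->]|[n ->]]; last by eexists.
by exists (pickle t); rewrite pickleK.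
Qed.

Section HeisenbergVirasoro.
Variables (R : realType) (V : lmodType R[i]) (d I : int -> V -> V) (z1 z2 z3 : V -> V).
Local Notation C := R[i].
Hypothesis HV : is_Lmodule d I z1 z2 z3.
Hypothesis HO : in_O_L d I.

Lemma L_ops_islin f : L_ops d I z1 z2 z3 f -> islin f.
Proof.
by case: HV => ? [? [? [? [? _]]]] [[n ->]|[[n ->]|[->|[->|->]]]].
Qed.

Lemma L_ops_enum : exists E : nat -> V -> V,
  forall f, L_ops d I z1 z2 z3 f <-> exists n, f = E n.
Proof.
pose F (t : int + int + option bool) := match t with
  | inl (inl n) => d n | inl (inr n) => I n
  | inr None => z1 | inr (Some true) => z2 | inr (Some false) => z3 end.
exists (fun n => F (odflt (inr None) (unpickle n))); apply: countType_enum => f.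
split; first by move=> [[n ->]|[[n ->]|[->|[->|->]]]];
  [exists (inl (inl n))|exists (inl (inr n))|exists (inr None)|exists (inr (Some true))|exists (inr (Some false))].
move=> [[[n|n]|[[]|]] ->] /=; rewrite /L_ops; by [left; exists n|right; left; exists n|tauto].
Qed.

Lemma H_ops_enum : exists E : nat -> V -> V, forall f, H_ops I z3 f <-> exists n, f = E n.
Proof.
pose F (t : option int) := if t is Some n then I n else z3.
exists (fun n => F (odflt None (unpickle n))); apply: countType_enum => f.
split; first by move=> [[n ->]|->]; [exists (Some n)|exists None].
by move=> [[n|] ->]; [left; exists n|right].
Qed.

Lemma central_scalar z : simple_mod (L_ops d I z1 z2 z3) ->
  z = z1 \/ z = z2 \/ z = z3 -> exists a, forall v, z v = a *: v.
Proof.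
move=> simV zz; have [E EP] := L_ops_enum.
apply: (dixmier_schur EP L_ops_islin simV).
  by apply: L_ops_islin; case: zz => [|[|]] ->; rewrite /L_ops; tauto.
case: HV => ? [? [? [? [? [? [? [? cen]]]]]]].
have [? [? [? [? ?]]]] := cen z zz.
by move=> f v [[n ->]|[[n ->]|[->|[->|->]]]].
Qed.

Variables (a b : C).
Hypothesis z3E : forall v, z3 v = a *: v.
Hypothesis z2E : forall v, z2 v = b *: v.
Hypothesis a_neq0 : a != 0.

Let linI n : islin (I n). Proof. by case: HV => _ []. Qed.
Let lind n : islin (d n). Proof. by case: HV. Qed.
Let linz1 : islin z1. Proof. by case: HV => _ [_ []]. Qed.
Let z1d n v : z1 (d n v) = d n (z1 v).
Proof. by case: HV => _ [_ [_ [_ [_ [_ [_ [_ /(_ z1)[]]]]]]]]; [left|move=> ->]. Qed.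
Let z1I n v : z1 (I n v) = I n (z1 v).
Proof. by case: HV => _ [_ [_ [_ [_ [_ [_ [_ /(_ z1)[]]]]]]]]; [left|move=> _ [-> _]]. Qed.
Let commI n m v : I n (I m v) - I m (I n v) = (n%:~R * delta R n m * a) *: v.
Proof. by case: HV => _ [_ [_ [_ [_ [_ [_ [-> _]]]]]]]; rewrite z3E scalerA. Qed.
Let commdI n m v : d n (I m v) - I m (d n v) =
  m%:~R *: I (m + n) v + (delta R n m * (n ^+ 2 + n)%:~R) *: (b *: v).
Proof. by case: HV => _ [_ [_ [_ [_ [_ [-> _]]]]]]; rewrite z2E. Qed.
Let commd n m v : d n (d m v) - d m (d n v) = (m - n)%:~R *: d (n + m) v
  + (delta R n m * ((n ^+ 3 - n)%:~R / 12%:R)) *: z1 v.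
Proof. by case: HV => _ [_ [_ [_ [_ [-> _]]]]]. Qed.
Lemma in_O_L_bound v : exists N : nat, forall i : int, N%:Z <= i -> I i v = 0.
Proof. by have [n [n0 nv]] := HO v; exists `|n|%N => i ni; apply: (nv i _).2; clear -ni n0; lia. Qed.
Let restrI := in_O_L_bound.

Local Notation D := (twisted_sugawara I a b).

(* The second Virasoro action, commuting with the Heisenberg algebra, and its
   central element. *)
Definition coset_d k v : V := d k v - D k v.
Definition coset_c v : V := z1 v - (1 - 12%:R * b ^+ 2 / a) *: v.

Lemma dE k v : d k v = D k v + coset_d k v.
Proof. by rewrite addrC subrK. Qed.

Lemma coset_d_islin k : islin (coset_d k).
Proof.
move=> c x y; rewrite /coset_d lind twisted_sugawara_islin //.
by rewrite opprD addrACA scalerBr.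
Qed.

Lemma coset_c_islin : islin coset_c.
Proof.
move=> c x y; rewrite /coset_c linz1 scale_islin.
by rewrite opprD addrACA scalerBr.
Qed.

Lemma coset_d_commI k m v : coset_d k (I m v) = I m (coset_d k v).
Proof.
rewrite /coset_d (islinB (linI m)) -[d k (I m v)](subrK (I m (d k v))) commdI.
rewrite -(twisted_sugawara_commI linI commI restrI b a_neq0).
by rewrite (AC (2*1*1) ((3*2)*(1*4))) /= subrr addr0.
Qed.

Lemma coset_c_commI m v : coset_c (I m v) = I m (coset_c v).
Proof. by rewrite /coset_c z1I (islinB (linI m)) (islinZ (linI m)). Qed.

Lemma coset_d_comm n m v : coset_d n (coset_d m v) - coset_d m (coset_d n v) =
  (m - n)%:~R *: coset_d (n + m) v
  + (delta R n m * ((n ^+ 3 - n)%:~R / 12%:R)) *: coset_c v.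
Proof.
have linD k : islin (D k) := twisted_sugawara_islin a linI restrI b k.
have lincd k := coset_d_islin k.
have cdD k l w : coset_d k (D l w) = D l (coset_d k w).
  by apply: commute_twisted_sugawara => // j u; apply: coset_d_commI.
(* The cross terms are written symmetrically in [k] and [l], so they cancel in the commutator and
   the bracket of [d] is the sum of the two brackets. *)
have dd k l : d k (d l v) =
    coset_d k (coset_d l v) + D k (D l v) + (D k (coset_d l v) + D l (coset_d k v)).
  rewrite !dE (islinD (linD k)) (islinD (lincd k)) cdD.
  by rewrite (AC (2*2) ((4*1)*(2*3))).
have : d n (d m v) - d m (d n v) = (coset_d n (coset_d m v) - coset_d m (coset_d n v))
    + (D n (D m v) - D m (D n v)).
  rewrite !dd [D m (coset_d n v) + _]addrC (opprD (_ + _)) addrACA subrr addr0.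
  by rewrite opprD addrACA.
move/(congr1 (fun x => x - (D n (D m v) - D m (D n v)))); rewrite addrK => <-.
rewrite commd twisted_sugawara_comm // /coset_d /coset_c !scalerBr.
by rewrite opprD addrACA.
Qed.

Lemma coset_c_d n v : coset_c (coset_d n v) = coset_d n (coset_c v).
Proof.
have linD k : islin (D k) := twisted_sugawara_islin a linI restrI b k.
rewrite /coset_c /coset_d (islinB linz1) z1d.
rewrite (commute_twisted_sugawara a linI restrI b _ _ linz1) //.
rewrite (islinB (lind n)) (islinB (linD n)) (islinZ (lind n)) (islinZ (linD n)) scalerBr.
by rewrite !opprB !addrA (AC ((1*1*1)*1) ((1*4)*(3*2))) /= addrA.
Qed.

Section SimpleHeisenberg.
Variable Hs : V -> Prop.
Hypothesis simpleHs : simple_sub (H_ops I z3) Hs.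

Lemma H_ops_islin f : H_ops I z3 f -> islin f.
Proof. by move=> [[n ->]|->]; apply: L_ops_islin; [right; left; exists n|right; right; tauto]. Qed.

Lemma commute_H_ops (T : V -> V) : islin T -> (forall m v, T (I m v) = I m (T v)) ->
  forall f v, H_ops I z3 f -> T (f v) = f (T v).
Proof. by move=> linT TI f v [[n ->] //|->]; rewrite !z3E (islinZ linT). Qed.

Lemma Hs_I k h : Hs h -> Hs (I k h).
Proof. by case: simpleHs => -[_ st] _; apply: st; left; exists k. Qed.

Lemma Hs_Hd k n h : Hs h -> Hs (Hd I a b k n h).
Proof.
have [[subH _] _] := simpleHs => Hh; rewrite /Hd; apply: (subspaceD subH); last first.
  exact/(subspaceZ subH)/Hs_I.
apply/(subspaceZ subH)/(subspace_sum subH) => j _.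
by rewrite /nord; case: ifP => _; apply/Hs_I/Hs_I.
Qed.

(** A cut-off valid for [h] is valid for [phi h], because [I j (phi h) = phi (I j h)]; the finite
    sum then passes through [phi]. *)
Lemma hom_Hd phi k n h : is_hom (H_ops I z3) Hs phi -> Hs h ->
  (forall j : int, n%:Z <= j -> I j h = 0) ->
  D k (phi h) = phi (Hd I a b k (n + `|k|)%N h).
Proof.
move=> hp Hh hn; have [[subH _] _] := simpleHs.
have opI m : H_ops I z3 (I m) by left; exists m.
have phiI m x : Hs x -> phi (I m x) = I m (phi x) by move=> Hx; apply: hp.2.
have Hnord p q : Hs (nord I p q h) by rewrite /nord; case: ifP => _; apply/Hs_I/Hs_I.
rewrite (twisted_sugawaraE a linI b k (N := n)) => [|j nj]; last first.
  by rewrite -phiI // hn // (hom_at0 simpleHs hp).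
rewrite /Hd hp.1; [|by apply: (subspace_sum subH)|exact/(subspaceZ subH)/Hs_I].
rewrite (homZ simpleHs _ hp) ?phiI //; last exact: Hs_I.
congr (_ *: _ + _); rewrite /sug (hom_bigsum simpleHs _ hp) //.
by apply: eq_bigr => j _; rewrite /nord; case: ifP => _; rewrite !phiI //; apply: Hs_I.
Qed.

End SimpleHeisenberg.
End HeisenbergVirasoro.

(** The terms [beta h 0] record that [I m], [z2] and [z3] act as 0 on the second factor. *)
Theorem theorem12 (R : realType) (V : lmodType R[i])
    (d I : int -> V -> V) (z1 z2 z3 : V -> V)
    (HV : is_Lmodule d I z1 z2 z3)
    (HO : in_O_L d I)
    (Hsimple : simple_mod (L_ops d I z1 z2 z3))
    (Hz3 : exists v : V, z3 v <> 0)
    (Hs : V -> Prop)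
    (HHs : simple_sub (H_ops I z3) Hs) :
  exists (z3d z2d : R[i]),
    z3d <> 0 /\ (forall h, Hs h -> z3 h = z3d *: h) /\
    exists (U : lmodType R[i]) (dU : int -> U -> U) (cU : U -> U),
      is_Virmodule dU cU /\ in_O_Vir dU /\ simple_mod (Vir_ops dU cU) /\
      exists beta : V -> U -> V,
        (* beta is bilinear on H x U *)
        (forall (a : R[i]) h1 h2 u, Hs h1 -> Hs h2 ->
            beta (a *: h1 + h2) u = a *: beta h1 u + beta h2 u) /\
        (forall (a : R[i]) h u1 u2, Hs h ->
            beta h (a *: u1 + u2) = a *: beta h u1 + beta h u2) /\
        (* the induced linear map H (x) U -> V is surjective ... *)
        (forall v : V, exists s : seq (V * U),
            (forall p, p \in s -> Hs p.1) /\ v = \sum_(p <- s) beta p.1 p.2) /\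
        (* ... and injective: sum_i beta h_i u_i = 0 forces sum_i h_i (x) u_i = 0,
           i.e. sum_i f(h_i) g(u_i) = 0 for all linear functionals f, g *)
        (forall s : seq (V * U), (forall p, p \in s -> Hs p.1) ->
            \sum_(p <- s) beta p.1 p.2 = 0 ->
            forall (f : V -> R[i]) (g : U -> R[i]), islinf f -> islinf g ->
              \sum_(p <- s) f p.1 * g p.2 = 0) /\
        (* ... and it intertwines the L-actions on H(z2d) (x) U^L and on V *)
        (forall h u, Hs h ->
           (forall m, I m (beta h u) = beta (I m h) u + beta h 0) /\
           z1 (beta h u) = beta ((1 - 12%:R * z2d ^+ 2 / z3d) *: h) u + beta h (cU u) /\
           z2 (beta h u) = beta (z2d *: h) u + beta h 0 /\
           z3 (beta h u) = beta (z3d *: h) u + beta h 0 /\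
           (forall (k : int) (n : nat), (forall j : int, n%:Z <= j -> I j h = 0) ->
              d k (beta h u) = beta (Hd I z3d z2d k (n + `|k|)%N h) u + beta h (dU k u))).
Proof.
have [z3d z3E] : exists a, forall v, z3 v = a *: v by apply: (central_scalar HV Hsimple); tauto.
have [z2d z2E] : exists a, forall v, z2 v = a *: v by apply: (central_scalar HV Hsimple); tauto.
have z3d_neq0 : z3d != 0.
  by case: Hz3 => v; rewrite z3E; apply: contra_notN => /eqP->; rewrite scale0r.
exists z3d, z2d; split; first exact/eqP; split=> [h _|]; first exact: z3E.
have [E EP] := H_ops_enum I z3; have opsH_lin := H_ops_islin HV.
have [_ [[h0 [Hh0 h0_neq0]] _]] := HHs.
have lind := coset_d_islin HV HO z3d z2d; have linc := coset_c_islin HV z3d z2d.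
have dI k := coset_d_commI HV HO z3E z2E z3d_neq0 k.
have cI := coset_c_commI HV z3d z2d.
have commd k := commute_H_ops z3E (lind k) (dI k).
have commc := commute_H_ops z3E linc cI.
pose U := multiplicity_space Hs h0 opsH_lin.
have valU (u : U) := subspace_val_in u.
pose dU k (u : U) : U := subspace_insub _ (multiplicity_stable (lind k) (commd k) (valU u)).
pose cU (u : U) : U := subspace_insub _ (multiplicity_stable linc commc (valU u)).
have valdU k u : val (dU k u) = coset_d d I z3d z2d k (val u) by [].
have valcU u : val (cU u) = coset_c z1 z3d z2d (val u) by [].
have lindU k : islin (dU k).
  by move=> x u v; apply: val_inj; rewrite valdU !subspace_valP2 lind.
have lincU : islin cU by move=> x u v; apply: val_inj; rewrite valcU !subspace_valP2 linc.
have tdU k h (u : U) : Hs h -> tensor_map h (dU k u) = coset_d d I z3d z2d k (tensor_map h u).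
  by move=> Hh; apply: (hom_of_post opsH_lin HHs) => //; apply: commd.
have tcU h (u : U) : Hs h -> tensor_map h (cU u) = coset_c z1 z3d z2d (tensor_map h u).
  by move=> Hh; apply: (hom_of_post opsH_lin HHs).
have hom_t (u : U) := tensor_map_hom u.
have tI m h (u : U) : Hs h -> I m (tensor_map h u) = tensor_map (I m h) u.
  by move=> Hh; rewrite (hom_t u).2 //; left; exists m.
have td k n h (u : U) : Hs h -> (forall j : int, n%:Z <= j -> I j h = 0) ->
    d k (tensor_map h u) = tensor_map (Hd I z3d z2d k (n + `|k|)%N h) u + tensor_map h (dU k u).
  move=> Hh hn; rewrite tdU // (dE d I z3d z2d k); congr (_ + _).
  exact: (hom_Hd HV z3d z2d HHs k (hom_t u) Hh hn).
have tc h (u : U) : Hs h -> z1 (tensor_map h u) =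
    tensor_map ((1 - 12%:R * z2d ^+ 2 / z3d) *: h) u + tensor_map h (cU u).
  by move=> Hh; rewrite tcU // (homZ HHs _ (hom_t u)) // addrC subrK.
have image_submodule (S : U -> Prop) : submodule (Vir_ops dU cU) S ->
    submodule (L_ops d I z1 z2 z3) (tensor_image S).
  move=> [subS stS]; have subT : subspace (tensor_image S) by apply: tensor_image_subspace.
  have tS h (u : U) : Hs h -> S u -> tensor_image S (tensor_map h u).
    by move=> ? ?; apply: tensor_image_pure.
  split=> // f opsf; apply: (tensor_image_stable HHs); first exact: L_ops_islin opsf.
  move=> h u Hh Su; case: opsf => [[k ->]|[[m ->]|[->|[->|->]]]].
  - have [n hn] := in_O_L_bound HO h; rewrite (td k n) //; apply: (subspaceD subT).
      by apply: tS => //; apply: (Hs_Hd _ _ HHs).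
    by apply: tS => //; apply: stS => //; left; exists k.
  - by rewrite tI //; apply: tS => //; apply: (Hs_I HHs).
  - rewrite tc //; apply: (subspaceD subT).
      by apply: tS => //; case: HHs => -[subH _] _; apply: (subspaceZ subH).
    by apply: tS => //; apply: stS => //; right.
  - by rewrite z2E; apply/(subspaceZ subT)/tS.
  - by rewrite z3E; apply/(subspaceZ subT)/tS.
pose u0 : U := subspace_insub _ (multiplicity_h0 (H_ops I z3) Hs h0).
have u0_neq0 : u0 <> 0 by move/(congr1 val).
(* Used twice: with [S] everything it gives surjectivity, and with [S] a nonzero submodule it gives
   simplicity of [U]. *)
have image_full (S : U -> Prop) u : submodule (Vir_ops dU cU) S -> S u -> u <> 0 ->
    forall v, tensor_image S v.
  move=> subS Su un0; have [_ [_ simV]] := Hsimple.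
  have [//|im0|imT v] := simV _ (image_submodule S subS); last exact: imT.
  case: un0; apply: val_inj; rewrite -(tensor_map_h0 u); apply: im0.
  exact: tensor_image_pure.
have submoduleT : submodule (Vir_ops dU cU) (fun _ => True) by [].
exists U, dU, cU; split; [|split; [|split]].
- split; [exact: lindU|split; [exact: lincU|split]] => n m.
    move=> u; apply: val_inj; rewrite subspace_valB subspace_valP2 subspace_valZ.
    exact: (coset_d_comm HV HO z3E z2E z3d_neq0).
  apply: val_inj; exact: (coset_c_d HV HO).
- move=> u; have [N uN] := in_O_L_bound HO (val u); have [n [n_gt0 un]] := HO (val u).
  (* From [n] on the operators [d i] kill [u], and from [2 N] on the Sugawara operators do. *)
  exists (n + (2 * N)%:Z); split=> [|i ni]; first by clear -n_gt0; lia.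
  apply: val_inj; rewrite valdU /coset_d (un i _).1; last by clear -ni; lia.
  rewrite (twisted_sugawara_eq0 _ _ _ uN) ?subr0 //; last by clear -ni n_gt0; lia.
  by case: HV => _ [].
- split; first by [].
  split; first by exists u0.
  move=> S subS _; have [[u [Su un0]]|noS] := pselect (exists u, S u /\ u <> 0); last first.
    by left=> u Su; apply: contrapT => un0; apply: noS; exists u.
  right=> w _; apply: (tensor_image_mem EP HHs Hh0 h0_neq0 subS.1).
  exact: image_full un0 _.
exists (@tensor_map _ _ _ _ _ opsH_lin); split; [|split; [|split; [|split]]].
- by move=> x h1 h2 u Hh1 Hh2; apply: (hom_t u).1.
- by move=> x h u1 u2 Hh; apply: (tensor_map_linr HHs).
- move=> v; have [s [Hss _] vs] := image_full _ u0 submoduleT Logic.I u0_neq0 v.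
  by exists s.
- by move=> s Hss s0 f g lf lg; apply: (tensor_map_inj EP HHs Hh0 h0_neq0 Hss s0).
move=> h u Hh; have t0 : tensor_map h (0 : U) = 0 by apply: (hom_of0 opsH_lin HHs).
split; first by move=> m; rewrite t0 addr0 tI.
split; first exact: tc.
split; first by rewrite t0 addr0 z2E (homZ HHs _ (hom_t u)).
split; first by rewrite t0 addr0 z3E (homZ HHs _ (hom_t u)).
by move=> k n; apply: td.
Qed.
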